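(* Let $\theta,\phi \in (0,\pi/2)$ and let $x \in \mathbb{X}_{\mathrm{TM}}$ be an element of the Thue--Morse subshift. Let $U = U_{x,\theta,\phi}$ be the quantum walk operator on $\ell^2(\mathbb{Z})\otimes\mathbb{C}^2$ with coins $C_n = R_\phi$ if $x_n = 0$ and $C_n = R_\theta$ if $x_n = 1$ ($n \in \mathbb{Z}$), and let $\widetilde\beta^{\pm}(p) = \widetilde\beta^{\pm}_{x,\theta,\phi}(p)$ be the corresponding time-averaged transport exponents for the initial state $\delta_0^+$. Then for all $p > 0$, $$\widetilde\beta^+(p) \ \ge\ \widetilde\beta^-(p) \ \ge\ 1 - \frac{1}{p}.$$
   Context: Thue--Morse subshift: let $\mathcal{A} = \{0,1\}$ and let $\sigma$ be the substitution $\sigma(0) = 01$, $\sigma(1) = 10$, extended by concatenation to finite words over $\mathcal{A}$. The words $w_n = \sigma^n(0)$ are such that $w_n$ is a prefix of $w_{n+1}$, so they define a limiting one-sided infinite word $w_{\mathrm{TM}} = 0110100110010110\cdots$. The Thue--Morse subshift $\mathbb{X}_{\mathrm{TM}}$ is the set of all $x:\mathbb{Z}\to\mathcal{A}$ such that every finite subword (block of consecutive letters) of $x$ is a subword of $w_{\mathrm{TM}}$. Quantum walk: let $\mathcal{H} = \ell^2(\mathbb{Z})\otimes\mathbb{C}^2$ with orthonormal basis $\delta_n^\pm = \delta_n\otimes e_\pm$, $n\in\mathbb{Z}$, where $e_+ = (1,0)^{\top}$, $e_- = (0,1)^{\top}$. Given coins $C_n = \begin{pmatrix} c_n^{11} &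 c_n^{12}\\ c_n^{21} & c_n^{22}\end{pmatrix}\in \mathbb{U}(2)$ (unitary $2\times 2$ matrices), $n \in \mathbb{Z}$, the quantum walk operator is the unitary operator $U = SC$, where $S\delta_n^{\pm} = \delta_{n\pm1}^{\pm}$ and $C\delta_n^+ = c_n^{11}\delta_n^+ + c_n^{21}\delta_n^-$, $C\delta_n^- = c_n^{12}\delta_n^+ + c_n^{22}\delta_n^-$. For $\gamma\in\mathbb{R}$, $R_\gamma = \begin{pmatrix}\cos\gamma & -\sin\gamma\\ \sin\gamma & \cos\gamma\end{pmatrix}$. Transport exponents: for $n \in \mathbb{Z}$ and $\ell\in\mathbb{Z}_{+}$ (including $\ell = 0$), put $$a(n,\ell) = |\langle\delta_n^+,U^\ell\delta_0^+\rangle|^2 + |\langle\delta_n^-,U^\ell\delta_0^+\rangle|^2.$$ For $L>0$, put $$\widetilde a(n,L) = (1-e^{-2/L})\sum_{\ell=0}^\infty e^{-2\ell/L}a(n,\ell),$$ and for $L,p>0$ put $$\langle|X|^p\rangle(L) = \sum_{n\in\mathbb{Z}}(|n|+1)^p\,\widetilde a(n,L).$$ The upper and lower transport exponents are $$\widetilde\beta^+(p) = \limsup_{L\to\infty}\frac{\log\left(\langle|X|^p\rangle(L)\right)}{p\log L},\qquad \widetilde\beta^-(p) = \liminf_{L\to\infty}\frac{\log\left(\langle|X|^p\rangle(L)\right)}{p\log L}.$$ *)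

(* Defs.v *)
From mathcomp Require Import all_boot all_order all_algebra.
From mathcomp Require Import spectral complex zify ring lra.
From mathcomp Require Import all_classical all_reals all_analysis.

Set Implicit Arguments.
Unset Strict Implicit.
Unset Printing Implicit Defensive.

Import Order.TTheory GRing.Theory Num.Theory.
Import numFieldNormedType.Exports.
Import ComplexField.Normc.

Local Open Scope classical_set_scope.
Local Open Scope ring_scope.
Local Open Scope sesquilinear_scope.

(* The letters 0 and 1 are [false] and [true]. *)

Definition tm_letter (b : bool) : seq bool := [:: b; ~~ b].

Definition tm_subst (w : seq bool) : seq bool := flatten (map tm_letter w).

Definition tm_word (n : nat) : seq bool := iter n tm_subst [:: false].

(* Position k of the limit word can be read off [tm_word k], of length
   2 ^ k > k; see [nth_tm_word]. *)
Definition tm_limit (k : nat) : bool := nth false (tm_word k) k.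

Lemma size_tm_word n : size (tm_word n) = (2 ^ n)%N.
Proof.
elim: n => //= n IH; rewrite expnS -{}IH /tm_subst.
by elim: (tm_word n) => //= b w ->; rewrite mulnS.
Qed.

Lemma tm_word_prefix n : prefix (tm_word n) (tm_word n.+1).
Proof.
elim: n => // n /prefixP[s IH]; have step m : tm_word m.+1 = tm_subst (tm_word m) by [].
by rewrite (step n.+1) {2}IH step /tm_subst map_cat flatten_cat prefix_prefix.
Qed.

Lemma nth_tm_word n k : (k < size (tm_word n))%N ->
  nth false (tm_word n) k = tm_limit k.
Proof.
have pre m d : prefix (tm_word m) (tm_word (m + d)).
  elim: d => [|d IH]; first by rewrite addn0 prefix_refl.
  by rewrite addnS (prefix_trans IH) ?tm_word_prefix.
have nth_pre m d : (k < size (tm_word m))%N ->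
    nth false (tm_word (m + d)) k = nth false (tm_word m) k.
  by move=> km; have /prefixP[s ->] := pre m d; rewrite nth_cat km.
move=> kn; rewrite /tm_limit.
have kk : (k < size (tm_word k))%N by rewrite size_tm_word ltn_expl.
by rewrite -(nth_pre _ k kn) -(nth_pre _ n kk) addnC.
Qed.

Definition thue_morse : set (int -> bool) :=
  [set x | forall (m : int) (len : nat), exists j : nat,
     forall i : nat, (i < len)%N -> x (m + i%:Z) = tm_limit (j + i)].

Section QuantumWalk.
Variable R : realType.
Implicit Types (psi chi : int -> 'cV[R[i]]_2) (coin : int -> 'M[R[i]]_2).

(* Vectors of l^2(Z) (x) C^2 are the psi : Z -> C^2 in [l2].  In C^2, the index
   [ord0] is the + component and [ord_max] the - component. *)

Definition l2normsq psi : \bar R :=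
  (\esum_(n in [set: int]) (\sum_(s < 2) normc (psi n s 0) ^+ 2)%:E)%E.

Definition l2 : set (int -> 'cV[R[i]]_2) := [set psi | (l2normsq psi < +oo)%E].

Definition delta (n : int) (s : 'I_2) : int -> 'cV[R[i]]_2 :=
  fun m => if m == n then delta_mx s 0 else 0.

(* Antilinear in the first argument.  The symmetric partial sums converge to
   the inner product since the series is absolutely convergent on [l2]. *)
Definition inner chi psi : R[i] :=
  lim ((fun N : nat => \sum_(k < N.*2.+1) \sum_(s < 2)
          (chi (k%:Z - N%:Z) s 0)^* * psi (k%:Z - N%:Z) s 0 : R[i]^o) @ \oo).

Definition shift psi : int -> 'cV[R[i]]_2 :=
  fun n => \col_s psi (if s == ord0 then n - 1 else n + 1) s 0.

Definition apply_coins coin psi : int -> 'cV[R[i]]_2 :=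
  fun n => coin n *m psi n.

Definition walk coin psi : int -> 'cV[R[i]]_2 := shift (apply_coins coin psi).

Definition rotation (g : R) : 'M[R[i]]_2 :=
  \matrix_(i < 2, j < 2)
    (if i == j then cos g else if i == ord0 then - sin g else sin g)%:C%C.

Definition tm_coins (x : int -> bool) (theta phi : R) : int -> 'M[R[i]]_2 :=
  fun n => if x n then rotation theta else rotation phi.

(* a(n, l) for the initial state delta_0^+. *)
Definition prob coin (n : int) (l : nat) : R :=
  \sum_(s < 2) normc (inner (delta n s) (iter l (walk coin) (delta 0 ord0))) ^+ 2.

(* The series have nonnegative terms and are summed in [\bar R], so that
   [moment] and [log_ratio] involve no convention for divergent sums.  These
   three are meaningful for L > 0 (resp. L > 1); only L -> +oo matters below. *)
Definition avg_prob coin (n : int) (L : R) : \bar R :=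
  ((1 - expR (- (2 / L)))%:E *
   \sum_(0 <= l <oo) (expR (- (2 * l%:R / L)) * prob coin n l)%:E)%E.

Definition moment coin (p L : R) : \bar R :=
  (\esum_(n in [set: int]) (((`|n%:~R| + 1) `^ p)%:E * avg_prob coin n L))%E.

Definition log_ratio coin (p L : R) : \bar R :=
  (lne (moment coin p L) * (p * ln L)^-1%:E)%E.

Definition upper_transport coin (p : R) : \bar R :=
  limf_esup (log_ratio coin p) (pinfty_nbhs R).

Definition lower_transport coin (p : R) : \bar R :=
  limf_einf (log_ratio coin p) (pinfty_nbhs R).

Lemma inner_delta n s psi : inner (delta n s) psi = psi n s 0.
Proof.
rewrite /inner; apply: (@lim_near_cst R[i]^o) => //.
near=> N.
have Nn : (absz n <= N)%N by near: N; exact: nbhs_infty_ge.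
have kP : (absz (n + N%:Z)%R < N.*2.+1)%N by lia.
have kE : (Ordinal kP)%:Z - N%:Z = n by rewrite /=; lia.
rewrite (bigD1 (Ordinal kP))//= [X in _ + X]big1 ?addr0 => [|k kn].
  rewrite (bigD1 s)//= big1 ?addr0 => [|t ts].
    by rewrite kE /delta eqxx mxE !eqxx conjC1 mul1r.
  by rewrite kE /delta eqxx mxE (negbTE ts) conjC0 mul0r.
apply: big1 => t _; rewrite /delta ifN ?mxE ?conjC0 ?mul0r//.
apply: contra kn => /eqP kn; apply/eqP/val_inj => /=; lia.
Unshelve. all: by end_near. Qed.

Lemma shift_delta n s :
  shift (delta n s) = delta (if s == ord0 then n + 1 else n - 1) s.
Proof.
apply/funext => m; apply/matrixP => t j; rewrite ord1 mxE /delta.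
have [->|ts] := eqVneq s t.
  suff -> : ((if t == ord0 then m - 1 else m + 1) == n) =
    (m == (if t == ord0 then n + 1 else n - 1)) by [].
  case: (t == ord0); first by rewrite subr_eq.
  by rewrite [RHS]eq_sym subr_eq eq_sym.
by do 2 case: ifP => _; rewrite ?mxE ?[t == s]eq_sym ?(negbTE ts).
Qed.

Lemma apply_coins_delta coin n s m :
  apply_coins coin (delta n s) m = \sum_(t < 2) coin n t s *: delta n t m.
Proof.
rewrite /apply_coins /delta; have [->|_] := eqVneq m n; last first.
  by rewrite mulmx0 big1// => t _; rewrite scaler0.
apply/matrixP => t j; rewrite ord1 -colE !mxE summxE (bigD1 t)//= big1 => [|r rt].
  by rewrite !mxE !eqxx mulr1 addr0.
by rewrite !mxE eq_sym (negbTE rt) mulr0.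
Qed.

Lemma rotation_unitary g : rotation g \is unitarymx.
Proof.
apply/unitarymxP/matrixP => i j; rewrite !mxE !big_ord_recl big_ord0 !mxE addr0.
have cs : cos g * cos g + sin g * sin g = 1 by rewrite -!expr2 cos2Dsin2.
move: i j => [[|[|//]] ?] [[|[|//]] ?] /=; apply/eqP; rewrite eq_complex /=;
  apply/andP; split; apply/eqP; lra.
Qed.

Lemma tm_coins_unitary x theta phi n : tm_coins x theta phi n \is unitarymx.
Proof. by rewrite /tm_coins; case: ifP => _; exact: rotation_unitary. Qed.

Lemma normsq_unitary (M : 'M[R[i]]_2) (v : 'cV[R[i]]_2) : M \is unitarymx ->
  \sum_(s < 2) normc ((M *m v) s 0) ^+ 2 = \sum_(s < 2) normc (v s 0) ^+ 2.
Proof.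
move=> MU; have nE (u : 'cV[R[i]]_2) :
    (\sum_(s < 2) normc (u s 0) ^+ 2)%:C%C = (u ^t* *m u) 0 0.
  rewrite rmorph_sum mxE; apply: eq_bigr => s _.
  by rewrite rmorphXn !mxE mulrC -normCK.
apply: complexI; rewrite !nE trmx_mul map_mxM mulmxA -(mulmxA (v ^t*)).
by rewrite -invmx_unitary// mulVmx ?unitarymx_unit// mulmx1.
Qed.

Lemma l2normsq_walk coin psi : (forall n, coin n \is unitarymx) ->
  l2normsq (walk coin psi) = l2normsq psi.
Proof.
move=> cU; pose A n (s : 'I_2) := (normc ((coin n *m psi n) s 0) ^+ 2)%:E.
have A0 n s : (0 <= A n s)%E by rewrite lee_fin sqr_ge0.
have o1 : lift ord0 ord0 = ord_max :> 'I_2 by exact: val_inj.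
have bijD (d : int) : set_bij [set: int] [set: int] (fun n => n + d).
  split=> [n|n m _ _ /addIr|n _] //; by exists (n - d); rewrite ?subrK.
transitivity (\esum_(n in [set: int]) (A n ord0 + A n ord_max))%E; last first.
  apply: eq_esum => n _; rewrite -(normsq_unitary _ (cU n)) !big_ord_recl big_ord0.
  by rewrite addr0 EFinD o1.
rewrite esumD// (@reindex_esum R _ _ _ _ _ _ (bijD (-1))).
rewrite [X in (_ + X)%E](@reindex_esum R _ _ _ _ _ _ (bijD 1)).
rewrite -esumD//; apply: eq_esum => n _.
rewrite !big_ord_recl big_ord0 addr0 EFinD /walk /shift !mxE.
by rewrite /A !mxE o1.
Qed.

Lemma walk_bij coin : (forall n, coin n \is unitarymx) -> bijective (walk coin).
Proof.
move=> cU; pose unshift psi : int -> 'cV[R[i]]_2 :=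
  fun n => \col_s psi (if s == ord0 then n + 1 else n - 1) s 0.
exists (apply_coins (fun n => invmx (coin n)) \o unshift) => psi; apply/funext => n.
  rewrite /apply_coins /= -[RHS](mulKmx (unitarymx_unit (cU n))); congr (_ *m _).
  apply/matrixP => s j; rewrite ord1 [LHS]mxE [LHS]mxE.
  by case: ifP => s0; rewrite s0 ?addrK ?subrK.
apply/matrixP => s j; rewrite ord1 mxE /apply_coins /=.
rewrite mulKVmx ?unitarymx_unit// mxE.
by case: ifP => s0; rewrite s0 ?addrK ?subrK.
Qed.

Lemma l2_walk coin : (forall n, coin n \is unitarymx) ->
  set_bij l2 l2 (walk coin).
Proof.
move=> cU; have [f walkK fK] := walk_bij cU.
split=> [psi|psi chi _ _ /(can_inj walkK)|psi psil2] //=.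
  by rewrite /l2/= l2normsq_walk.
by exists (f psi); rewrite ?fK // /l2/= -(l2normsq_walk _ cU) fK.
Qed.

End QuantumWalk.

(* Main.v *)
Require Import Defs.
From mathcomp Require Import all_boot all_order all_algebra.
From mathcomp Require Import complex zify ring lra.
From mathcomp Require Import all_classical all_reals all_analysis.

Import Order.TTheory GRing.Theory Num.Theory.
Import numFieldNormedType.Exports.
Import ComplexField.Normc.

Local Open Scope classical_set_scope.
Local Open Scope ring_scope.

(** Write [r = exp (- 2 / L)] and let [q0] be a complex number of modulus 1.
    The vector [u = \sum_l (r q0)^l U^l delta_0^+] is a value of the resolvent
    of the walk, and Cauchy-Schwarz in time with the weights [r ^ l] shows that
    [avg_prob n L >= (1 - r)^2 |u(n)|^2], where [1 - r] has order [1 / L]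
    ([damped_sum_le_avg_prob]).  One well-chosen [q0] is enough: if [u] is
    bounded below on [h] consecutive sites at distance about [h] from the
    origin, with [h] of order [L], then the moment is at least
    [h * h^p * c / L^2], of order [L^(p - 1)], and the exponent [1 - 1 / p]
    follows ([lower_transport_ge]).

    Away from the origin, [u = r q0 U u] is a recursion for the pairs
    [(u_n^+, u_(n-1)^-)] whose 2 x 2 transfer matrices have determinant 1.
    The number [q0] is chosen so that the product [A B] of the two transfer
    matrices at [q0] has trace 0.  Then [A B] and [B A] both square to [-1].
    The Thue-Morse word is made of blocks of 8 letters in which these products
    are arranged as [(AB)(BA)(BA)(AB)] or [(BA)(AB)(AB)(BA)], so every block has
    the identity as its transfer matrix, and all transfer matrices at [q0],
    however long the word, are bounded ([bounded_transfer_products]).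

    Replacing [q0] by [r q0] changes each transfer matrix by [O(1 / L)].  Hence,
    in the frame given by the transfer products at [q0], the pairs of [u] drift
    by a relative amount [O(1 / L)] per site, which is harmless over a stretch of
    [O(L)] sites.  The source [delta_0^+] makes the frame coordinates jump by a
    fixed amount between the sites -1 and 0, so they cannot be small at both;
    on the side where they are not, they stay bounded below
    ([one_sided_lower], [resolvent_one_sided_lower]).

    Only finite sums over time are used: cutting the series after [T] steps
    adds the error [(r q0)^T U^T delta_0^+], whose entries are at most [r ^ T]
    because the walk is unitary. *)

Set Implicit Arguments.
Unset Strict Implicit.

(** * The Thue-Morse sequence *)

Lemma nth_tm_subst w k :
  (nth false (tm_subst w) k.*2 = nth false w k) /\
  ((k < size w)%N -> nth false (tm_subst w) k.*2.+1 = ~~ nth false w k).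
Proof.
by elim: w k => [|b w IH] [|k] //=; rewrite nth_nil.
Qed.

Lemma tm_limit_double k : tm_limit k.*2 = tm_limit k.
Proof.
have kk : (k < size (tm_word k))%N by rewrite size_tm_word ltn_expl.
rewrite -(@nth_tm_word k.+1) ?(proj1 (nth_tm_subst (tm_word k) k))//.
by rewrite size_tm_word expnS mul2n ltn_double -(size_tm_word k).
Qed.

Lemma tm_limit_doubleS k : tm_limit k.*2.+1 = ~~ tm_limit k.
Proof.
have kk : (k < size (tm_word k))%N by rewrite size_tm_word ltn_expl.
rewrite -(@nth_tm_word k.+1) ?(proj2 (nth_tm_subst (tm_word k) k))//.
by rewrite size_tm_word expnS mul2n -doubleS leq_double -(size_tm_word k).
Qed.

(** The block [tm_limit (8 q), ..., tm_limit (8 q + 7)] is the third substitution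
    iterate of the letter [tm_limit q]. *)
Lemma tm_limit_octuple q (b := tm_limit q) :
  [seq tm_limit (8 * q + i) | i <- iota 0 8]
    = [:: b; ~~ b; ~~ b; b; ~~ b; b; b; ~~ b].
Proof.
have -> : (8 * q = q.*2.*2.*2)%N by lia.
rewrite /= addn0 -!addSnnS !addn0.
by rewrite -!doubleS !(tm_limit_double, tm_limit_doubleS) ?negbK.
Qed.

(** * Complex 2 x 2 matrices *)

Section Matrices2.
Variable R : realType.
Local Notation C := R[i].
Implicit Types (A B W : 'M[C]_2) (v w : 'cV[C]_2) (K : R).

Lemma normcD (x y : C) : normc (x + y) <= normc x + normc y.
Proof. exact: le_normcD. Qed.

Lemma normc_opp (x : C) : normc (- x) = normc x.
Proof. exact: normcN. Qed.

Lemma normc_ge0 (x : C) : 0 <= normc x.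
Proof. by case: x => a b; exact: sqrtr_ge0. Qed.

Lemma normc_real (a : R) : normc a%:C%C = `|a|.
Proof. by rewrite /normc /= expr0n /= addr0 sqrtr_sqr. Qed.

Lemma normcX (x : C) n : normc (x ^+ n) = normc x ^+ n.
Proof. by elim: n => [|n IH]; rewrite ?normc1// !exprS normcM IH. Qed.

Lemma normc_sum (I : Type) (s : seq I) (F : I -> C) :
  normc (\sum_(i <- s) F i) <= \sum_(i <- s) normc (F i).
Proof.
elim: s => [|i s IH]; first by rewrite !big_nil normc0.
by rewrite !big_cons (le_trans (normcD _ _))// lerD2l.
Qed.

Lemma sum_ord2 (V : nmodType) (F : 'I_2 -> V) :
  \sum_(i < 2) F i = F ord0 + F ord_max.
Proof.
rewrite !big_ord_recl big_ord0 addr0; congr (_ + F _); exact: val_inj.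
Qed.

Lemma ord2_ind (P : 'I_2 -> Prop) : P ord0 -> P ord_max -> forall i, P i.
Proof.
move=> P0 P1 [[|[|//]] i2].
  by rewrite (_ : Ordinal i2 = ord0)//; exact: val_inj.
by rewrite (_ : Ordinal i2 = ord_max)//; exact: val_inj.
Qed.

Lemma mulmx2 n (A : 'M[C]_2) (B : 'M[C]_(2, n)) i j :
  (A *m B) i j = A i ord0 * B ord0 j + A i ord_max * B ord_max j.
Proof. by rewrite mxE sum_ord2. Qed.

Lemma adj_mx2 (A : 'M[C]_2) i j :
  (\adj A) i j = if i == j then A (rev_ord i) (rev_ord i) else - A i j.
Proof.
have lift0 : lift ord0 ord0 = ord_max :> 'I_2 by exact: val_inj.
have lift1 : lift ord_max ord0 = ord0 :> 'I_2 by exact: val_inj.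
have rev0 : rev_ord ord0 = ord_max :> 'I_2 by exact: val_inj.
have rev1 : rev_ord ord_max = ord0 :> 'I_2 by exact: val_inj.
rewrite mxE /cofactor det_mx11 !mxE.
by move: i j; apply: ord2_ind; apply: ord2_ind;
  rewrite /= ?(lift0, lift1, rev0, rev1) ?expr0 ?expr1 ?sqrrN ?expr1n ?mulN1r ?mul1r.
Qed.

Lemma det_mx2 (A : 'M[C]_2) :
  \det A = A ord0 ord0 * A ord_max ord_max - A ord0 ord_max * A ord_max ord0.
Proof.
have := congr1 (fun B : 'M[C]_2 => B ord0 ord0) (mul_mx_adj A).
rewrite mulmx2 !adj_mx2 !mxE /= mulr1n => <-.
by rewrite (_ : rev_ord ord0 = ord_max) ?mulrN//; exact: val_inj.
Qed.

(** By Cayley-Hamilton. *)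
Lemma sqr_traceless2 A :
  \det A = 1 -> A ord0 ord0 + A ord_max ord_max = 0 -> A *m A = - 1%:M.
Proof.
rewrite det_mx2 => dA /eqP; rewrite addr_eq0 => /eqP tA.
apply/matrixP; apply: ord2_ind; apply: ord2_ind;
  rewrite mulmx2 !mxE /= !(mulr1n, mulr0n) -?dA tA; ring.
Qed.

Definition vnorm v : R := normc (v ord0 0) + normc (v ord_max 0).

Lemma vnorm_ge0 v : 0 <= vnorm v.
Proof. by rewrite addr_ge0 ?normc_ge0. Qed.

Lemma vnormD v w : vnorm (v + w) <= vnorm v + vnorm w.
Proof.
rewrite /vnorm !mxE addrACA lerD ?normcD//.
Qed.

Lemma vnormN v : vnorm (- v) = vnorm v.
Proof. by rewrite /vnorm !mxE !normc_opp. Qed.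

Lemma vnorm_mulmx A v K : (forall i j, normc (A i j) <= K) ->
  vnorm (A *m v) <= 2 * K * vnorm v.
Proof.
move=> AK; have rowP i : normc ((A *m v) i 0) <= K * vnorm v.
  rewrite mulmx2 (le_trans (normcD _ _))// !normcM mulrDr.
  by rewrite lerD ?ler_wpM2r ?normc_ge0.
rewrite -mulrA mulr_natl mulr2n; exact: lerD.
Qed.

Lemma normc_adj_mx2 A K : (forall i j, normc (A i j) <= K) ->
  forall i j, normc ((\adj A) i j) <= K.
Proof. by move=> AK i j; rewrite adj_mx2; case: ifP => _; rewrite ?normc_opp. Qed.

Lemma mul_adj_det1 A : \det A = 1 -> \adj A *m A = 1%:M.
Proof. by move=> dA; rewrite mul_adj_mx dA. Qed.

Lemma mulmx_adj_det1 A : \det A = 1 -> A *m \adj A = 1%:M.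
Proof. by move=> dA; rewrite mul_mx_adj dA. Qed.

(** Variation of constants: in the frame given by a solution [W] of the recursion
    [W' = A W], only the defect [v' - A v] moves a vector. *)
Lemma variation_of_constants W W' A v v' : W' = A *m W -> \det W = 1 -> \det W' = 1 ->
  \adj W' *m v' - \adj W *m v = \adj W' *m (v' - A *m v).
Proof.
move=> WE dW dW'; rewrite mulmxBr; congr (_ - _).
rewrite -[v in RHS]mul1mx -(mulmx_adj_det1 dW) !mulmxA -(mulmxA _ A W) -WE mul_adj_det1//.
by rewrite mul1mx.
Qed.

End Matrices2.

(** * Matrix products along the Thue-Morse sequence *)

Section Cocycle.
Variable R : realType.
Local Notation C := R[i].
Implicit Types (M : bool -> 'M[C]_2) (K : R).

Fixpoint tm_cocycle M (k : nat) : 'M[C]_2 :=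
  if k is k'.+1 then M (tm_limit k') *m tm_cocycle M k' else 1%:M.

Lemma det_tm_cocycle M k :
  (forall b, \det (M b) = 1) -> \det (tm_cocycle M k) = 1.
Proof. by move=> dM; elim: k => [|k IH] /=; rewrite ?det1// det_mulmx dM IH mulr1. Qed.

(** With [A] and [B] the matrices of [tm_limit q] and of the other letter, a block
    contributes [(B A)(A B)(A B)(B A) = (B A)(- 1)(B A) = 1]. *)
Lemma tm_cocycle_octuple M q :
  (forall b, M b *m M (~~ b) *m (M b *m M (~~ b)) = - 1%:M) ->
  tm_cocycle M (8 * q) = 1%:M.
Proof.
move=> sq; elim: q => [|q IH]; first by rewrite muln0.
have -> : (8 * q.+1 = (8 * q + 7).+1)%N by lia.
rewrite !(addnS, addn0) /= IH mulmx1.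
have := tm_limit_octuple q; rewrite /= !(addnS, addn0) => -[-> -> -> -> -> -> -> ->].
move: (sq (tm_limit q)) (sq (~~ tm_limit q)); rewrite negbK.
set A := M (tm_limit q); set B := M (~~ tm_limit q) => sAB sBA.
transitivity (B *m A *m (A *m B *m (A *m B)) *m (B *m A)); first by rewrite !mulmxA.
by rewrite sAB mulmxN mulmx1 mulNmx sBA opprK.
Qed.

(** Complete blocks cancel, and fewer than 8 factors remain. *)
Lemma normc_tm_cocycle M K : 1 <= K ->
  (forall b, M b *m M (~~ b) *m (M b *m M (~~ b)) = - 1%:M) ->
  (forall b i j, normc (M b i j) <= K) ->
  forall k i j, normc (tm_cocycle M k i j) <= (2 * K) ^+ 8.
Proof.
move=> K1 sq MK k; have K2 : 1 <= 2 * K by lra.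
have bnd q r : forall i j, normc (tm_cocycle M (8 * q + r) i j) <= (2 * K) ^+ r.
  elim: r => [|r IH] i j.
    rewrite addn0 tm_cocycle_octuple// mxE.
    by case: (i == j); rewrite ?normc1 ?normc0 ?expr0.
  rewrite addnS /= mulmx2 (le_trans (normcD _ _))// !normcM exprS -mulrA mulr_natl mulr2n.
  by apply: lerD; rewrite ler_pM ?normc_ge0.
move=> i j; rewrite {1}(divn_eq k 8) mulnC (le_trans (bnd _ _ _ _))//.
by rewrite ler_weXn2l// ltnW// ltn_mod.
Qed.

(** Every finite window of [x] occurs in the limit word, so it carries a solution
    of the matrix recursion made of values of [tm_cocycle]. *)
Lemma thue_morse_window M (x : int -> bool) (N : nat) : thue_morse x ->
  exists W : int -> 'M[C]_2,
    (forall n, - N%:Z <= n < N%:Z -> W (n + 1) = M (x n) *m W n) /\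
    (forall n, exists k, W n = tm_cocycle M k).
Proof.
move=> /(_ (- N%:Z) (N + N).+1)[j jE].
exists (fun n => tm_cocycle M (j + `|(n + N%:Z)%R|%N)); split=> n; last by eexists.
move=> nN.
have lt : (`|(n + N%:Z)%R| < (N + N).+1)%N by lia.
have nE : - N%:Z + `|(n + N%:Z)%R|%N%:Z = n by lia.
have nS : `|(n + 1 + N%:Z)%R|%N = `|(n + N%:Z)%R|%N.+1 by lia.
by rewrite nS addnS /= -(jE _ lt) nE.
Qed.

End Cocycle.

(** * Transfer matrices of the walk *)

Section Transfer.
Variable R : realType.
Local Notation C := R[i].
Implicit Types (g r K : R) (q : C) (v : 'cV[C]_2).
Implicit Types (u : int -> 'cV[C]_2) (coin : int -> 'M[C]_2).

(** The solutions of [u = q U u] satisfy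
    [(u_(n+1)^+, u_n^-) = transfer g q (u_n^+, u_(n-1)^-)] if the coin at [n] is
    [rotation g]. *)
Definition transfer g q : 'M[C]_2 :=
  \matrix_(i, j) ((cos g)%:C%C^-1 *
    (if i == j then if i == ord0 then q else q^-1 else - (sin g)%:C%C)).

Lemma unit_neq0 q : normc q = 1 -> q != 0.
Proof.
by move=> q1; apply/eqP => q0; move/eqP: q1; rewrite q0 normc0 eq_sym oner_eq0.
Qed.

Lemma cosC_neq0 g : 0 < cos g -> (cos g)%:C%C != 0 :> C.
Proof. by move=> c0; rewrite (fmorph_eq0 (real_complex R)) gt_eqF. Qed.

Lemma cosC2DsinC2 g : (cos g)%:C%C ^+ 2 + (sin g)%:C%C ^+ 2 = 1 :> C.
Proof. by rewrite -!rmorphXn -rmorphD /= cos2Dsin2. Qed.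

Lemma det_transfer g q : 0 < cos g -> q != 0 -> \det (transfer g q) = 1.
Proof.
move=> /cosC_neq0 c0 q0; rewrite det_mx2 !mxE /=.
transitivity ((1 - (sin g)%:C%C ^+ 2) / (cos g)%:C%C ^+ 2 : C).
  by field; rewrite q0 c0.
by rewrite -[X in X - _](cosC2DsinC2 g) addrK divff// expf_neq0.
Qed.

(** The hypothesis on [q] says that [transfer g q *m transfer h q] has trace 0. *)
Lemma sqr_transferM g h q : 0 < cos g -> 0 < cos h -> q != 0 ->
  q ^+ 2 + q ^- 2 = - (2 * (sin g)%:C%C * (sin h)%:C%C) ->
  transfer g q *m transfer h q *m (transfer g q *m transfer h q) = - 1%:M.
Proof.
move=> c0 d0 q0 tq; apply: sqr_traceless2.
  by rewrite det_mulmx !det_transfer// mulr1.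
have cg := cosC_neq0 c0; have ch := cosC_neq0 d0.
rewrite !mulmx2 !mxE /=.
transitivity ((q ^+ 2 + q ^- 2 + 2 * (sin g)%:C%C * (sin h)%:C%C) / ((cos g)%:C%C * (cos h)%:C%C)).
  by field; rewrite q0 cg ch.
by rewrite tq addNr mul0r.
Qed.

(** For [q = exp (i t)] the equation reads [cos (2 t) = - a]. *)
Lemma unit_trace_zero (a : R) : -1 <= a <= 1 ->
  exists2 q : C, normc q = 1 & q ^+ 2 + q ^- 2 = - (2 * a%:C%C).
Proof.
move=> /andP[a0 a1].
have x2 : Num.sqrt ((1 - a) / 2) ^+ 2 = (1 - a) / 2 by rewrite sqr_sqrtr//; lra.
have y2 : Num.sqrt ((1 + a) / 2) ^+ 2 = (1 + a) / 2 by rewrite sqr_sqrtr//; lra.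
set x := Num.sqrt _ in x2; set y := Num.sqrt _ in y2.
pose q : C := (x +i* y)%C; pose q' : C := (x -i* y)%C.
have qq' : q * q' = 1.
  by apply/eqP; rewrite eq_complex /=; apply/andP; split; apply/eqP; lra.
have qV : q^-1 = q' by exact: mulr1_eq.
have xy : x ^+ 2 + y ^+ 2 = 1 by rewrite x2 y2; lra.
exists q; first by rewrite /q /normc /= xy sqrtr1.
rewrite -exprVn qV !expr2; apply/eqP; rewrite eq_complex /=; apply/andP; split; apply/eqP; lra.
Qed.

Definition site_vec u (n : int) : 'cV[C]_2 :=
  \col_s (if s == ord0 then u n s 0 else u (n - 1) s 0).

(** These two identities eliminate [e = u_(n+1)^+] and [d = u_n^-] from the components
    of the walk equation; [a] and [b] stand for [u_n^+] and [u_(n-1)^-]. *)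
Lemma transfer_step_plus (c s q a b d e : C) : c != 0 -> c ^+ 2 + s ^+ 2 = 1 ->
  e - (c^-1 * q * a + c^-1 * - s * b) =
  e - q * (c * a + - s * d) + s / c * (b - q * (s * a + c * d)).
Proof.
by move=> c0 cs; rewrite -[in X in X * q](mul1r c^-1) -cs; field.
Qed.

Lemma transfer_step_minus (c s q a b d : C) : c != 0 -> q != 0 ->
  d - (c^-1 * - s * a + c^-1 * q^-1 * b) = - ((b - q * (s * a + c * d)) / (q * c)).
Proof. by move=> c0 q0; field; rewrite q0 c0. Qed.

Lemma walk_rotation_plus coin u g n : coin (n - 1) = rotation g ->
  walk coin u n ord0 0 =
    (cos g)%:C%C * u (n - 1) ord0 0 + - (sin g)%:C%C * u (n - 1) ord_max 0.
Proof.
by move=> coinE; rewrite mxE /apply_coins eqxx mulmx2 coinE !mxE eqxx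
  -(rmorphN (real_complex R)).
Qed.

Lemma walk_rotation_minus coin u g n : coin (n + 1) = rotation g ->
  walk coin u n ord_max 0 =
    (sin g)%:C%C * u (n + 1) ord0 0 + (cos g)%:C%C * u (n + 1) ord_max 0.
Proof. by move=> coinE; rewrite mxE /apply_coins mulmx2 coinE !mxE eqxx. Qed.

(** The defect of the transfer recursion at [n] only involves the defect [f] of the
    walk equation at [n - 1] and [n + 1]. *)
Lemma site_vec_step coin u q g n (f := fun m => u m - q *: walk coin u m) :
  0 < cos g -> q != 0 -> coin n = rotation g ->
  site_vec u (n + 1) - transfer g q *m site_vec u n =
  \col_s (if s == ord0
    then f (n + 1) ord0 0 + (sin g)%:C%C / (cos g)%:C%C * f (n - 1) ord_max 0
    else - (f (n - 1) ord_max 0 / (q * (cos g)%:C%C))).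
Proof.
move=> /cosC_neq0 c0 q0 coinE.
have fE m s : f m s 0 = u m s 0 - q * walk coin u m s 0.
  by rewrite /f [LHS]mxE [X in _ + X]mxE [X in - X]mxE.
move: f fE => f fE.
have fm : f (n - 1) ord_max 0 = u (n - 1) ord_max 0
    - q * ((sin g)%:C%C * u n ord0 0 + (cos g)%:C%C * u n ord_max 0).
  by rewrite fE (@walk_rotation_minus _ _ g) subrK.
have fp : f (n + 1) ord0 0 = u (n + 1) ord0 0
    - q * ((cos g)%:C%C * u n ord0 0 + - (sin g)%:C%C * u n ord_max 0).
  by rewrite fE (@walk_rotation_plus _ _ g) addrK.
apply/colP; apply: ord2_ind; rewrite [RHS]mxE /= ?fm ?fp;
  rewrite [LHS]mxE [X in _ + X]mxE mulmx2 !mxE /= ?addrK.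
  exact: transfer_step_plus (cosC2DsinC2 g).
exact: transfer_step_minus.
Qed.

Lemma normc_transfer g q K : 0 < cos g -> normc q = 1 -> (cos g)^-1 <= K ->
  forall i j, normc (transfer g q i j) <= K.
Proof.
move=> c0 q1 cK i j; rewrite mxE normcM normcV normc_real (ger0_norm (ltW c0)).
suff h : normc (if i == j then if i == ord0 then q else q^-1 else - (sin g)%:C%C) <= 1.
  by apply: le_trans cK; rewrite ler_piMr// invr_ge0 ltW.
case: ifP => _; first by case: ifP => _; rewrite ?normcV q1 ?invr1.
by rewrite normc_opp normc_real ler_norml sin_geN1 sin_le1.
Qed.

(** The two matrices differ on the diagonal only, by [(r - 1) q] and [(1 / r - 1) / q]
    up to the factor [1 / cos g]. *)
Lemma vnorm_transferB g r q v : 0 < cos g -> 1 / 2 <= r <= 1 -> normc q = 1 ->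
  vnorm ((transfer g (r%:C%C * q) - transfer g q) *m v)
    <= 2 * (1 - r) * (cos g)^-1 * vnorm v.
Proof.
move=> c0 /andP[r0 r1] q1; have r_gt0 : 0 < r by lra.
have q0 := unit_neq0 q1.
have rC : (r%:C%C : C) != 0 by rewrite (fmorph_eq0 (real_complex R)) gt_eqF.
have ci : 0 <= (cos g)^-1 by rewrite invr_ge0 ltW.
rewrite /vnorm !mulmx2 !mxE /= !subrr !mul0r addr0 add0r -!mulrBr.
rewrite !normcM normcV normc_real (ger0_norm (ltW c0)).
have -> : r%:C%C * q - q = (r - 1)%:C%C * q by rewrite rmorphB /=; ring.
have -> : (r%:C%C * q)^-1 - q^-1 = ((1 - r) / r)%:C%C * q^-1.
  by rewrite rmorphM fmorphV rmorphB /=; field; rewrite q0 rC.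
rewrite !normcM !normcV q1 invr1 !normc_real !mulr1 distrC.
rewrite (ger0_norm (_ : 0 <= 1 - r)) ?subr_ge0// ger0_norm ?divr_ge0 ?subr_ge0 ?(ltW r_gt0)//.
have h : (1 - r) / r <= 2 * (1 - r).
  by rewrite ler_pdivrMr//; nra.
have a0 := normc_ge0 (v ord0 0); have b0 := normc_ge0 (v ord_max 0).
have h1 : 1 - r <= 2 * (1 - r) by lra.
have -> : 2 * (1 - r) / cos g * (normc (v ord0 0) + normc (v ord_max 0)) =
  (cos g)^-1 * (2 * (1 - r)) * normc (v ord0 0)
    + (cos g)^-1 * (2 * (1 - r)) * normc (v ord_max 0) by ring.
by apply: lerD; apply: ler_wpM2r => //; apply: ler_wpM2l.
Qed.

(** At a [q] for which the product of the two transfer matrices has trace 0, the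
    blocks of the Thue-Morse word act as the identity. *)
Lemma bounded_transfer_products (theta phi : R)
    (ang := fun b : bool => if b then theta else phi) :
  0 < cos theta -> 0 < cos phi ->
  exists q K, [/\ normc q = 1, 1 <= K &
    forall k i j, normc (tm_cocycle (fun b => transfer (ang b) q) k i j) <= K].
Proof.
move=> ct cf.
have a1 : -1 <= sin theta * sin phi <= 1.
  have st : `|sin theta| <= 1 by rewrite ler_norml sin_geN1 sin_le1.
  have sf : `|sin phi| <= 1 by rewrite ler_norml sin_geN1 sin_le1.
  by rewrite -ler_norml normrM -[leRHS]mul1r ler_pM.
have [q q1 qa] := unit_trace_zero a1; have q0 := unit_neq0 q1.
have ca b : 0 < cos (ang b) by rewrite /ang; case: b.
have inv_cos_ge1 b : 1 <= (cos (ang b))^-1.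
  by rewrite invr_ge1 ?cos_le1// ?unitfE ?gt_eqF ?ca.
have Dt := inv_cos_ge1 true; have Df := inv_cos_ge1 false.
pose D : R := (cos (ang true))^-1 + (cos (ang false))^-1.
have cD b : (cos (ang b))^-1 <= D by rewrite /D; case: b; lra.
have D1 : 1 <= D by rewrite /D; lra.
exists q, ((2 * D) ^+ 8); split=> //; first by rewrite exprn_ege1//; lra.
apply: normc_tm_cocycle => // b; last by move=> i j; exact: normc_transfer.
by apply: sqr_transferM => //; rewrite qa rmorphM /= /ang; case: b => /=; ring.
Qed.

End Transfer.

(** * Propagation of a lower bound away from a source *)

(** The site 0 goes with the positive side because the jump caused by the source
    takes place between the sites -1 and 0. *)
Definition on_one_side (N : nat) (P : int -> Prop) : Prop :=
  (forall i : nat, (i <= N)%N -> P i%:Z) \/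
  (forall i : nat, (0 < i <= N)%N -> P (- i%:Z)).

Lemma on_one_side_impl N (P Q : int -> Prop) :
  (forall n, P n -> Q n) -> on_one_side N P -> on_one_side N Q.
Proof. by move=> PQ [H|H]; [left | right] => i /H/PQ. Qed.

Section DriftEstimate.
Variable R : realType.
Local Notation C := R[i].
Implicit Types (k e b : R).

(** Bernoulli's inequality [(1 - k) ^ i >= 1 - i k], with an absolute error [e] per
    step. *)
Lemma slow_decay (f : nat -> R) k e (N : nat) : 0 <= k <= 1 -> 0 <= e -> 0 <= f 0%N ->
  (forall i, (i < N)%N -> (1 - k) * f i - e <= f i.+1) ->
  forall i, (i <= N)%N -> (1 - i%:R * k) * f 0%N - i%:R * e <= f i.
Proof.
move=> /andP[k0 k1] e0 f0 step; elim=> [|i IH] iN; first by rewrite !mul0r !subr0 mul1r.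
apply: le_trans (step i iN); move/(_ (ltnW iN)): IH.
have i0 : 0 <= i%:R :> R by [].
rewrite -natr1; set a := f 0%N in f0 *; set x := f i; set t : R := i%:R in i0 * => IH.
have : (1 - k) * ((1 - t * k) * a - t * e) <= (1 - k) * x by rewrite ler_wpM2l// subr_ge0.
have : 0 <= t * k * k * a by rewrite !mulr_ge0.
have : 0 <= k * t * e by rewrite !mulr_ge0.
lra.
Qed.

(** The jump [g] between the sites -1 and 0 forces [w] to be of size [b / 4] at one of
    them; the loss during at most [N] steps in that direction is a factor [1 - N k >= 1 / 2]
    and a term [N e <= b / 16]. *)
Lemma one_sided_lower (w : int -> 'cV[C]_2) (g : 'cV[C]_2) k e b (N : nat) :
  0 <= k -> 0 <= e -> (0 < N)%N -> N%:R * k <= 1 / 2 -> N%:R * e <= b / 16 ->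
  0 < b <= vnorm g ->
  (forall n : int, - N%:Z <= n < N%:Z ->
    vnorm (w (n + 1) - w n - (if n == -1 then g else 0)) <= k * vnorm (w n) + e) ->
  on_one_side N (fun n => b / 16 <= vnorm (w n)).
Proof.
move=> k0 e0 N0 Nk Ne /andP[b0 bg] step.
have N1 : 1 <= N%:R :> R by rewrite ler1n.
have k12 : k <= 1 / 2 by apply: le_trans Nk; rewrite ler_peMl.
have e16 : e <= b / 16 by apply: le_trans Ne; rewrite ler_peMl.
have k01 : 0 <= k <= 1 by apply/andP; split=> //; lra.
have stepn n : - N%:Z <= n < N%:Z -> n != -1 ->
    vnorm (w (n + 1) - w n) <= k * vnorm (w n) + e.
  by move=> /step + /negbTE nN1; rewrite nN1 subr0.
have end_bound (f : nat -> R) (M : nat) : (M <= N)%N -> b / 4 <= f 0%N ->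
    (forall i, (i < M)%N -> (1 - k) * f i - e <= f i.+1) ->
    forall i, (i <= M)%N -> b / 16 <= f i.
  move=> MN f0 fstep i iM; have f0' : 0 <= f 0%N by lra.
  apply: le_trans (slow_decay k01 e0 f0' fstep iM).
  have iN : i%:R <= N%:R :> R by rewrite ler_nat (leq_trans iM).
  have ik : i%:R * k <= 1 / 2 by apply: le_trans Nk; rewrite ler_wpM2r.
  have ie : i%:R * e <= b / 16 by apply: le_trans Ne; rewrite ler_wpM2r.
  have : (1 / 2) * f 0%N <= (1 - i%:R * k) * f 0%N by rewrite ler_wpM2r//; lra.
  lra.
have triangle (x y : 'cV[C]_2) z : vnorm (x - y) <= z -> vnorm x <= vnorm y + z.
  move=> xyz; rewrite -[x](subrK y) (le_trans (vnormD _ _))// addrC lerD2l//.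
have triangle' (x y : 'cV[C]_2) z : vnorm (x - y) <= z -> vnorm y <= vnorm x + z.
  by move=> xyz; apply: triangle; rewrite -vnormN opprB.
have [w0|w0] := leP (b / 4) (vnorm (w 0)).
  left; apply: (end_bound (fun i => vnorm (w i%:Z))) => // i iN.
  have nN : - N%:Z <= i%:Z < N%:Z by apply/andP; split; clear -N0 iN; lia.
  have nN1 : i%:Z != -1 by clear; lia.
  have := triangle' _ _ _ (stepn _ nN nN1).
  have -> : i%:Z + 1 = i.+1%:Z by clear; lia.
  lra.
right; have wN1 : b / 4 <= vnorm (w (-1)).
  have nN : - N%:Z <= -1 < N%:Z by apply/andP; split; clear -N0; lia.
  have := step _ nN; rewrite eqxx => gle.
  have g3 : vnorm g <= vnorm (w 0 - w (-1)) + (k * vnorm (w (-1)) + e).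
    by apply: triangle'; move: gle; rewrite (_ : -1 + 1 = 0 :> int).
  have := vnormD (w 0) (- w (-1)); rewrite vnormN.
  have : k * vnorm (w (-1)) <= 1 / 2 * vnorm (w (-1)) by rewrite ler_wpM2r ?vnorm_ge0.
  lra.
have lft : forall i, (i <= N.-1)%N -> b / 16 <= vnorm (w (- i.+1%:Z)).
  apply: (end_bound (fun i => vnorm (w (- i.+1%:Z)))) => // [|i iN]; first exact: leq_pred.
  have nN : - N%:Z <= - i.+2%:Z < N%:Z by apply/andP; split; clear -N0 iN; lia.
  have nN1 : - i.+2%:Z != -1 by clear; lia.
  have := triangle _ _ _ (stepn _ nN nN1).
  have -> : - i.+2%:Z + 1 = - i.+1%:Z by clear; lia.
  set x := vnorm (w (- i.+1%:Z)); set y := vnorm (w (- i.+2%:Z)) => xy.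
  have y0 : 0 <= y by exact: vnorm_ge0.
  (* [x <= (1 + k) y + e] and [1 - k <= 1 / (1 + k)]: going left costs the same factor. *)
  have : (1 - k) * (x - e) <= (1 - k) * ((1 + k) * y) by rewrite ler_wpM2l//; lra.
  have : 0 <= k * k * y by rewrite !mulr_ge0.
  have : 0 <= k * e by rewrite mulr_ge0.
  lra.
case=> [//|i] /andP[_ iN]; apply: lft; clear -iN; lia.
Qed.

End DriftEstimate.

(** * The damped sum over time *)

Section DampedSum.
Variable R : realType.
Local Notation C := R[i].
Implicit Types (coin : int -> 'M[C]_2) (q : C).

Lemma walk_sum coin (T : nat) (a : nat -> C) (psi : nat -> int -> 'cV[C]_2) n :
  walk coin (fun m => \sum_(l < T) a l *: psi l m) n =
  \sum_(l < T) a l *: walk coin (psi l) n.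
Proof.
apply/colP => s; rewrite summxE mxE /apply_coins mulmx_sumr summxE.
apply: eq_bigr => l _; rewrite -scalemxAr [LHS]mxE [RHS]mxE.
by rewrite [X in _ = _ * X]mxE.
Qed.

Definition damped_sum coin q T : int -> 'cV[C]_2 := fun n =>
  \sum_(l < T) q ^+ l *: iter l (walk coin) (delta R 0 ord0) n.

(** The terms of the sum telescope under [1 - q U]. *)
Lemma damped_sumE coin q T n (u := damped_sum coin q T) :
  u n - q *: walk coin u n =
  delta R 0 ord0 n - q ^+ T *: iter T (walk coin) (delta R 0 ord0) n.
Proof.
rewrite /u [walk _ _ _](walk_sum coin T (fun l => q ^+ l)
  (fun l => iter l (walk coin) (delta R 0 ord0))).
rewrite scaler_sumr -sumrB.
transitivity (\sum_(0 <= l < T) (q ^+ l *: iter l (walk coin) (delta R 0 ord0) n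
   - q ^+ l.+1 *: iter l.+1 (walk coin) (delta R 0 ord0) n)).
  by rewrite big_mkord; apply: eq_bigr => l _; rewrite scalerA -exprS.
rewrite -[LHS]opprK -sumrN; under eq_bigr do rewrite opprB.
by rewrite telescope_sumr// opprB expr0 scale1r.
Qed.

(** Unitarity: no entry exceeds the norm of the initial state. *)
Lemma normc_iter_walk coin T n s : (forall m, coin m \is unitarymx) ->
  normc (iter T (walk coin) (delta R 0 ord0) n s 0) <= 1.
Proof.
move=> cU; set psi := iter _ _ _.
have psi1 : l2normsq psi = 1%:E.
  rewrite {}/psi; elim: T => [|T IH]; last by rewrite /= l2normsq_walk.
  rewrite /= /l2normsq (esumID [set 0])//; last first.
    by move=> m _; rewrite lee_fin sumr_ge0// => t _; rewrite sqr_ge0.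
  rewrite setTI esum_set1; last by rewrite lee_fin sumr_ge0// => t _; rewrite sqr_ge0.
  rewrite esum1 ?adde0; last first.
    move=> m [_ /= /eqP m0]; rewrite /delta (negbTE m0) big1// => t _.
    by rewrite mxE normc0 expr0n.
  by rewrite /delta eqxx sum_ord2 !mxE !eqxx /=
    expr0n expr1n !addr0 sqrtr1 sqrtr0 expr0n expr1n addr0.
rewrite -(ler_pXn2r (n := 2)) ?nnegrE ?normc_ge0// expr1n -lee_fin -psi1.
apply: esum_ge; exists [set n]; first by split=> //; exact: finite_set1.
rewrite fsbig_set1 lee_fin (bigD1 s)//= lerDl sumr_ge0// => t _; exact: sqr_ge0.
Qed.

(** Cauchy-Schwarz for the weights [r ^ l], whose sum is at most [1 / (1 - r)]:
    expand [\sum_l r ^ l (y l - (1 - r) B)^2 >= 0], where [B = \sum_l r ^ l y l]. *)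
Lemma weighted_cauchy_schwarz (T : nat) (r : R) (y : nat -> R) : 0 <= r < 1 ->
  (1 - r) * (\sum_(l < T) r ^+ l * y l) ^+ 2 <= \sum_(l < T) r ^+ l * y l ^+ 2.
Proof.
move=> /andP[r0 r1]; set B := \sum_(l < T) _; set D := \sum_(l < T) _.
have S1 : (1 - r) * \sum_(l < T) r ^+ l <= 1.
  by rewrite -opprB mulNr -subrX1 opprB gerBl exprn_ge0.
set S := \sum_(l < T) _ in S1.
have : 0 <= \sum_(l < T) r ^+ l * (y l - (1 - r) * B) ^+ 2.
  by apply: sumr_ge0 => l _; rewrite mulr_ge0 ?sqr_ge0 ?exprn_ge0.
have sqE c : \sum_(l < T) r ^+ l * (y l - c) ^+ 2 = D - 2 * c * B + c ^+ 2 * S.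
  rewrite /D /B /S !mulr_sumr -sumrB -big_split/=; apply: eq_bigr => l _; ring.
rewrite sqE.
have : (1 - r) * B ^+ 2 * ((1 - r) * S) <= (1 - r) * B ^+ 2 * 1.
  by rewrite ler_wpM2l// mulr_ge0 ?sqr_ge0// subr_ge0 ltW.
rewrite !expr2; lra.
Qed.

(** The weights [expR (- (2 l / L))] in [avg_prob] are the powers of [normc q]. *)
Lemma damped_sum_le_avg_prob coin (q : C) (L : R) T n :
  0 < L -> normc q = expR (- (2 / L)) ->
  (((1 - normc q) ^+ 2 * (vnorm (damped_sum coin q T n) ^+ 2 / 2))%:E
    <= avg_prob coin n L)%E.
Proof.
move=> L0 qr; rewrite /avg_prob -qr; set r := normc q.
have r01 : 0 <= r < 1.
  by rewrite normc_ge0 /r qr expR_lt1 oppr_lt0 divr_gt0.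
have rl l : expR (- (2 * l%:R / L)) = r ^+ l.
  by rewrite /r qr -expRM_natr; congr expR; ring.
have p0 l : 0 <= prob coin n l.
  by rewrite sumr_ge0// => s _; rewrite sqr_ge0.
apply: (@le_trans _ _ ((1 - r)%:E * \sum_(0 <= l < T) (expR (- (2 * l%:R / L)) * prob coin n l)%:E)%E); last first.
  apply: lee_wpmul2l; first by rewrite lee_fin subr_ge0; case/andP: r01 => _ /ltW.
  by apply: nneseries_lim_ge => l _ _; rewrite lee_fin mulr_ge0 ?expR_ge0.
rewrite sumEFin -EFinM lee_fin expr2 -mulrA ler_wpM2l//.
  by rewrite subr_ge0; case/andP: r01 => _ /ltW.
pose y s l := normc (iter l (walk coin) (delta R 0 ord0) n s 0).
have us s : normc (damped_sum coin q T n s 0) <= \sum_(l < T) r ^+ l * y s l.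
  rewrite summxE (le_trans (normc_sum _ _))// ler_sum// => l _.
  by rewrite mxE normcM normcX.
have us2 s : (1 - r) * normc (damped_sum coin q T n s 0) ^+ 2
     <= \sum_(l < T) r ^+ l * y s l ^+ 2.
  apply: le_trans (weighted_cauchy_schwarz T (y s) r01).
  apply: ler_wpM2l; first by rewrite subr_ge0; case/andP: r01 => _ /ltW.
  by rewrite ler_pXn2r ?nnegrE ?normc_ge0// (le_trans _ (us s)) ?normc_ge0.
have -> : \sum_(0 <= l < T) expR (- (2 * l%:R / L)) * prob coin n l
   = \sum_(l < T) r ^+ l * y ord0 l ^+ 2 + \sum_(l < T) r ^+ l * y ord_max l ^+ 2.
  rewrite big_mkord -big_split/=; apply: eq_bigr => l _.
  by rewrite rl /prob sum_ord2 !inner_delta mulrDr.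
apply: le_trans (lerD (us2 ord0) (us2 ord_max)); rewrite -mulrDr ler_wpM2l//.
  by rewrite subr_ge0; case/andP: r01 => _ /ltW.
by rewrite /vnorm; set a := normc _; set b := normc _; have := sqr_ge0 (a - b); rewrite !expr2; lra.
Qed.

End DampedSum.

(** * Lower bound for the damped sum *)

Section ResolventLowerBound.
Variable R : realType.
Local Notation C := R[i].

Lemma subr_split (V : zmodType) (x y z : V) : z - y = x - y + (z - x).
Proof. by rewrite [RHS]addrC addrA subrK. Qed.

Lemma delta_plus m : delta R 0 ord0 m ord0 0 = (m == 0)%:R.
Proof. by rewrite /delta; case: eqP; rewrite mxE. Qed.

Lemma delta_minus m : delta R 0 ord0 m ord_max 0 = 0.
Proof. by rewrite /delta; case: eqP; rewrite mxE. Qed.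

(** [u] solves [u = r q U u + delta_0^+] up to the error [e], and [W] is a bounded
    solution of the transfer recursion at the undamped parameter [q].  The vectors
    [\adj (W n) *m site_vec u n] meet the hypotheses of [one_sided_lower]: the damping
    gives the relative drift, [e] the absolute one, and [delta_0^+] the jump, of size at
    least [1 / (2 K)] because [W 0] has norm at most [2 K]. *)
Lemma resolvent_one_sided_lower (g : int -> R) (coin : int -> 'M[C]_2) (q : C)
    (W : int -> 'M[C]_2) (K D r rho : R) (N : nat) (u e : int -> 'cV[C]_2) :
  (forall n, coin n = rotation (g n)) ->
  (forall n, 0 < cos (g n)) -> (forall n, (cos (g n))^-1 <= D) ->
  normc q = 1 -> 1 / 2 <= r <= 1 -> 0 < K -> (0 < N)%N ->
  (forall n, - N%:Z <= n < N%:Z -> W (n + 1) = transfer (g n) q *m W n) ->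
  (forall n, \det (W n) = 1) -> (forall n i j, normc (W n i j) <= K) ->
  (forall n, u n - (r%:C%C * q) *: walk coin u n = delta R 0 ord0 n - e n) ->
  (forall n s, normc (e n s 0) <= rho) ->
  N%:R * (8 * K ^+ 2 * D * (1 - r)) <= 1 / 2 ->
  N%:R * (8 * K * D * rho) <= (32 * K)^-1 ->
  on_one_side N (fun n => (64 * K ^+ 2)^-1 <= 2 * vnorm (u n) + rho).
Proof.
move=> coinE c0 cD q1 r01 K0 N0 WE dW WK res erho Nk Ne.
pose b : R := (64 * K ^+ 2)^-1.
have [r12 r1] := andP r01; have r0 : 0 < r by lra.
have q0 := unit_neq0 q1.
have rq0 : r%:C%C * q != 0.
  by rewrite mulf_neq0// (fmorph_eq0 (real_complex R)) gt_eqF.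
have rho0 : 0 <= rho by apply: le_trans (erho 0 ord0); exact: normc_ge0.
have D1 : 1 <= D by apply: le_trans (cD 0); rewrite invr_ge1 ?cos_le1// ?unitfE ?gt_eqF ?c0.
(* Since [\det (W n) = 1], [w n] is the coordinate vector of [site_vec u n] in the frame
   [W n]. *)
pose w n := \adj (W n) *m site_vec u n.
have sw n : site_vec u n = W n *m w n by rewrite /w mulmxA mulmx_adj_det1// mul1mx.
have swK n : vnorm (site_vec u n) <= 2 * K * vnorm (w n).
  by rewrite sw; exact: vnorm_mulmx.
have wK n v : vnorm (\adj (W n) *m v) <= 2 * K * vnorm v.
  by apply: vnorm_mulmx; exact: normc_adj_mx2.
pose s0 : 'cV[C]_2 := delta_mx ord0 0.
have s01 : vnorm s0 = 1 by rewrite /vnorm !mxE /= expr0n expr1n !addr0 sqrtr1 sqrtr0 addr0.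
have defect n : - N%:Z <= n < N%:Z -> vnorm (w (n + 1) - w n
    - (if n == -1 then \adj (W 0) *m s0 else 0)) <=
    8 * K ^+ 2 * D * (1 - r) * vnorm (w n) + 8 * K * D * rho.
  move=> nN; rewrite /w (variation_of_constants _ _ (WE n nN))//.
  pose src : 'cV[C]_2 := if n == -1 then s0 else 0.
  have -> : (if n == -1 then \adj (W 0) *m s0 else 0) = \adj (W (n + 1)) *m src.
    by rewrite /src; case: eqP => [->|_]; rewrite ?addNr ?mulmx0.
  rewrite -mulmxBr (le_trans (wK _ _))//.
  set A := transfer (g n) q; set A' := transfer (g n) (r%:C%C * q).
  pose err := site_vec u (n + 1) - A' *m site_vec u n - src.
  have -> : site_vec u (n + 1) - A *m site_vec u n - src = (A' - A) *m site_vec u n + err.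
    by rewrite /err mulmxBl addrA [X in X - src = _](subr_split (A' *m site_vec u n)).
  have errK : vnorm err <= 4 * D * rho.
    (* The source is exactly the contribution of [delta_0^+], at [n = -1]. *)
    have errE : err = \col_s (if s == ord0
        then - e (n + 1) ord0 0 - (sin (g n))%:C%C / (cos (g n))%:C%C * e (n - 1) ord_max 0
        else e (n - 1) ord_max 0 / (r%:C%C * q * (cos (g n))%:C%C)).
      rewrite /err /A' (site_vec_step u (c0 n) rq0 (coinE n)) /=.
      rewrite !res /src; apply/colP; apply: ord2_ind; rewrite !mxE /=.
        by rewrite delta_plus delta_minus addr_eq0; case: (n == -1); rewrite mxE /=; ring.
      by rewrite delta_minus; case: (n == -1); rewrite mxE /=; ring.
    have e1 := erho (n + 1) ord0; have e2 := erho (n - 1) ord_max.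
    rewrite errE /vnorm !mxE /=.
    have := normcD (- e (n + 1) ord0 0) (- ((sin (g n))%:C%C / (cos (g n))%:C%C * e (n - 1) ord_max 0)).
    rewrite !normc_opp !normcM !normcV !normcM q1 mulr1 !normc_real.
    rewrite (ger0_norm (ltW (c0 n))) (ger0_norm (ltW r0)).
    set x := normc _ in e1 *; set y := normc _ in e2 *; set z := normc _.
    have s1 : `|sin (g n)| <= 1 by rewrite ler_norml sin_geN1 sin_le1.
    have c1 := cD n; have ci : 0 <= (cos (g n))^-1 by rewrite invr_ge0 ltW.
    have y0 : 0 <= y by exact: normc_ge0.
    have h1 : `|sin (g n)| / cos (g n) * y <= D * rho.
      apply: ler_pM => //; first by rewrite mulr_ge0.
      by rewrite -[leRHS]mul1r ler_pM.
    have r2 : r^-1 <= 2 by rewrite -[r^-1]mul1r ler_pdivrMr//; lra.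
    have h2 : y * (r * cos (g n))^-1 <= rho * (2 * D).
      apply: ler_pM => //; first by rewrite invr_ge0 mulr_ge0 ?(ltW r0) ?(ltW (c0 n)).
      by rewrite invfM; apply: ler_pM => //; rewrite invr_ge0 ltW.
    have h3 : rho <= D * rho by rewrite ler_peMl.
    lra.
  have AK : vnorm ((A' - A) *m site_vec u n) <= 2 * (1 - r) * D * (2 * K * vnorm (w n)).
    apply: le_trans (vnorm_transferB _ (c0 n) r01 q1) _.
    apply: ler_pM (swK n) => //; rewrite ?vnorm_ge0 ?mulr_ge0 ?subr_ge0 ?invr_ge0 ?(ltW (c0 n))//.
    by rewrite ler_wpM2l ?mulr_ge0 ?subr_ge0.
  have -> : 8 * K ^+ 2 * D * (1 - r) * vnorm (w n) + 8 * K * D * rho =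
    2 * K * (2 * (1 - r) * D * (2 * K * vnorm (w n)) + 4 * D * rho) by ring.
  rewrite ler_wpM2l ?mulr_ge0 ?(ltW K0)// (le_trans (vnormD _ _))// lerD//.
have base : 0 < (2 * K)^-1 <= vnorm (\adj (W 0) *m s0).
  rewrite invr_gt0 mulr_gt0//=.
  have := vnorm_mulmx (\adj (W 0) *m s0) (WK 0).
  rewrite mulmxA mulmx_adj_det1// mul1mx s01 => h.
  by rewrite -[leLHS]mul1r ler_pdivrMr ?mulr_gt0// mulrC.
(* The entry [u_(n-1)^-] of [site_vec u n] is a contraction of [u n], up to [rho]. *)
have site n : (2 * K)^-1 / 16 <= vnorm (w n) -> b <= 2 * vnorm (u n) + rho.
  have := wK n (site_vec u n); rewrite -/(w n) => wn wb.
  have bs : b <= vnorm (site_vec u n).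
    rewrite -(ler_pM2l (_ : 0 < 2 * K)) ?mulr_gt0//; apply: le_trans wn; apply: le_trans wb.
    by rewrite /b le_eqVlt; apply/orP; left; apply/eqP; field; rewrite gt_eqF.
  apply: (le_trans bs); rewrite /vnorm !mxE /=.
  have um : u (n - 1) ord_max 0 = r%:C%C * q *
      ((sin (g n))%:C%C * u n ord0 0 + (cos (g n))%:C%C * u n ord_max 0) - e (n - 1) ord_max 0.
    have wE : walk coin u (n - 1) ord_max 0 =
        (sin (g n))%:C%C * u n ord0 0 + (cos (g n))%:C%C * u n ord_max 0.
      by rewrite (@walk_rotation_minus _ _ _ (g n)) subrK.
    rewrite -wE; have subE (f h : 'cV[C]_2) i : (f - h) i 0 = f i 0 - h i 0.
      by rewrite [LHS]mxE [X in _ + X]mxE.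
    have scaleE (a : C) (h : 'cV[C]_2) i : (a *: h) i 0 = a * h i 0 by rewrite [LHS]mxE.
    have /colP/(_ ord_max) := res (n - 1).
    by rewrite !subE scaleE delta_minus add0r => /eqP; rewrite subr_eq (addrC (- _)) => /eqP.
  have := normcD (r%:C%C * q * ((sin (g n))%:C%C * u n ord0 0 + (cos (g n))%:C%C * u n ord_max 0))
    (- e (n - 1) ord_max 0).
  rewrite -um normc_opp !normcM q1 mulr1 normc_real (ger0_norm (ltW r0)).
  have := normcD ((sin (g n))%:C%C * u n ord0 0) ((cos (g n))%:C%C * u n ord_max 0).
  rewrite !normcM !normc_real (ger0_norm (ltW (c0 n))); set m := normc (_ + _).
  have := erho (n - 1) ord_max; set x := normc (u n ord0 0); set y := normc (u n ord_max 0).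
  have x0 : 0 <= x by exact: normc_ge0.
  have y0 : 0 <= y by exact: normc_ge0.
  have : `|sin (g n)| * x <= x by rewrite ler_piMl// ler_norml sin_geN1 sin_le1.
  have : cos (g n) * y <= y by rewrite ler_piMl// cos_le1.
  have : r * m <= m by rewrite ler_piMl// normc_ge0.
  lra.
have k0 : 0 <= 8 * K ^+ 2 * D * (1 - r).
  by rewrite !mulr_ge0 ?sqr_ge0 ?subr_ge0//; lra.
have e0 : 0 <= 8 * K * D * rho by rewrite !mulr_ge0//; lra.
have Ne' : N%:R * (8 * K * D * rho) <= (2 * K)^-1 / 16.
  have Ki : 0 < K^-1 by rewrite invr_gt0.
  by apply: le_trans Ne _; rewrite !invfM; lra.
exact: on_one_side_impl site (one_sided_lower k0 e0 N0 Nk Ne' base defect).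
Qed.

End ResolventLowerBound.

(** * Spreading of the walk *)

Section Spreading.
Variable R : realType.
Local Notation C := R[i].

Lemma damping_bounds (L : R) : 4 <= L ->
  L^-1 <= 1 - expR (- (2 / L)) <= 2 / L.
Proof.
move=> L4; have L0 : 0 < L by lra.
have y1 : 2 / L <= 1 / 2 by rewrite ler_pdivrMr//; lra.
have y0 : 0 < 2 / L by rewrite divr_gt0.
have LV : L^-1 = 2 / L / 2 by rewrite mulrAC divff ?mul1r.
rewrite [X in X <= _]LV; have lb := expR_ge1Dx (- (2 / L)).
have : expR (- (2 / L)) * (1 + 2 / L) <= 1.
  rewrite -[leRHS](mulVf (lt0r_neq0 (expR_gt0 (2 / L)))) -expRN ler_wpM2l ?expR_ge0//.
  exact: expR_ge1Dx.
move: y0 y1 lb; set y := 2 / L; set r := expR _ => y0 y1 lb ry.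
apply/andP; split; last by lra.
suff : r <= 1 - y / 2 by lra.
have y11 : 0 <= y * (1 - y) by apply: mulr_ge0; lra.
by rewrite -(ler_pM2r (_ : 0 < 1 + y)); lra.
Qed.

(** Combines the bounded transfer products with [damping_bounds]: over at most
    [cd.2 * L] sites the damping costs at most a factor 2. *)
Lemma thue_morse_one_sided (theta phi : R) :
  0 < theta < pi / 2 -> 0 < phi < pi / 2 ->
  exists cd : R * R, [/\ 0 < cd.1, 0 < cd.2 &
    forall (x : int -> bool) (L : R) (N : nat), thue_morse x -> 4 <= L ->
      (0 < N)%N -> N%:R <= cd.2 * L ->
      on_one_side N (fun n =>
        (cd.1 / L ^+ 2)%:E <= avg_prob (tm_coins x theta phi) n L)%E].
Proof.
move=> /andP[t0 t1] /andP[f0 f1]; have pi0 := pi_gt0 R.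
have ct : 0 < cos theta by apply: cos_gt0_pihalf; apply/andP; split; lra.
have cf : 0 < cos phi by apply: cos_gt0_pihalf; apply/andP; split; lra.
have [q [K [q1 K1 cK]]] := bounded_transfer_products ct cf.
have q0 := unit_neq0 q1.
pose ang b := if b then theta else phi; pose M b := transfer (ang b) q.
have {}cK k i j : normc (tm_cocycle M k i j) <= K by exact: cK.
have ca b : 0 < cos (ang b) by rewrite /ang; case: b.
have dM b : \det (M b) = 1 by exact: det_transfer.
pose D : R := (cos theta)^-1 + (cos phi)^-1.
have cti : 1 <= (cos theta)^-1 by rewrite invr_ge1 ?cos_le1// ?unitfE ?gt_eqF ?ct.
have cfi : 1 <= (cos phi)^-1 by rewrite invr_ge1 ?cos_le1// ?unitfE ?gt_eqF ?cf.
have cD b : (cos (ang b))^-1 <= D by rewrite /D /ang; case: b => /=; lra.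
have D1 : 1 <= D by rewrite /D; lra.
clear t0 t1 f0 f1 pi0 cti cfi; move: D cD D1 => D cD D1.
have K0 : 0 < K by lra.
have D0 : 0 < D by lra.
pose b : R := (64 * K ^+ 2)^-1.
have b0 : 0 < b by rewrite invr_gt0 mulr_gt0// exprn_gt0.
(* The damped sum will have norm at least [b / 4] at each site, and [1 - r >= 1 / L]; the second constant
   makes the relative drift [8 K^2 D (1 - r)], where [1 - r <= 2 / L], at most [1 / 2]
   in total. *)
exists (b ^+ 2 / 32, (32 * K ^+ 2 * D)^-1); split => [||x L N hx L4 N0 NL] /=.
- by rewrite divr_gt0// exprn_gt0.
- by rewrite invr_gt0 !mulr_gt0// exprn_gt0.
have L0 : 0 < L by lra.
set coin := tm_coins x theta phi.
have coinE n : coin n = rotation (ang (x n)) by rewrite /coin /tm_coins /ang; case: (x n).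
have coinU n : coin n \is unitarymx by exact: tm_coins_unitary.
have Li0 : 0 < L^-1 by rewrite invr_gt0.
have L2 : 2 / L <= 1 / 2 by rewrite ler_pdivrMr//; lra.
have /andP[r_ub r_lb] := damping_bounds L4.
pose r := expR (- (2 / L)); rewrite -/r in r_ub r_lb.
have r_gt : 0 < r by exact: expR_gt0.
have r01 : 1 / 2 <= r <= 1 by apply/andP; split; lra.
have r1 : r < 1 by lra.
have [W [WE Wk]] := thue_morse_window M N hx.
have dW n : \det (W n) = 1 by have [k ->] := Wk n; exact: det_tm_cocycle.
have WK n i j : normc (W n i j) <= K by have [k ->] := Wk n; exact: cK.
have N1 : 1 <= N%:R :> R by rewrite ler1n.
(* [T] is large enough for the truncation error to be negligible even after [N] steps. *)
pose rho := b / (16 * K * D * N%:R).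
have den0 : 2 <= 16 * K * D * N%:R.
  have KD : 1 <= K * D by rewrite mulr_ege1.
  have := mulr_ege1 KD N1; rewrite -!mulrA; lra.
have rho0 : 0 < rho by rewrite divr_gt0//; lra.
have rhob : rho <= b / 2 by rewrite ler_wpM2l ?(ltW b0)// lef_pV2 ?posrE//; lra.
have [T rT] : exists T, r ^+ T <= rho.
  have := @cvg_expr R r; rewrite ger0_norm ?(ltW r_gt)// => /(_ r1)/cvgr0_norm_le/(_ _ rho0)[T _ HT].
  by exists T; have := HT T (leqnn T); rewrite /= ger0_norm// exprn_ge0// ltW.
pose u := damped_sum coin (r%:C%C * q) T.
pose e n := (r%:C%C * q) ^+ T *: iter T (walk coin) (delta R 0 ord0) n.
have nrq : normc (r%:C%C * q) = r by rewrite normcM q1 mulr1 normc_real ger0_norm ?ltW.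
have ue n : u n - (r%:C%C * q) *: walk coin u n = delta R 0 ord0 n - e n.
  exact: damped_sumE.
have erho n s : normc (e n s 0) <= rho.
  rewrite mxE normcM normcX nrq (le_trans _ rT)// ler_piMr ?exprn_ge0 ?(ltW r_gt)//.
  exact: normc_iter_walk.
have Nk : N%:R * (8 * K ^+ 2 * D * (1 - r)) <= 1 / 2.
  have KD0 : 0 < 8 * K ^+ 2 * D by rewrite !mulr_gt0// exprn_gt0.
  apply: (@le_trans _ _ ((32 * K ^+ 2 * D)^-1 * L * (8 * K ^+ 2 * D * (2 / L)))).
    apply: ler_pM => //; first by rewrite mulr_ge0 ?(ltW KD0)//; lra.
    by rewrite ler_wpM2l ?(ltW KD0)//; lra.
  by rewrite le_eqVlt; apply/orP; left; apply/eqP; field; rewrite !gt_eqF.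
have Ne : N%:R * (8 * K * D * rho) <= (32 * K)^-1.
  have -> : N%:R * (8 * K * D * rho) = (128 * K ^+ 2)^-1.
    rewrite /rho /b; field; rewrite !gt_eqF//; lra.
  have KK : K <= K ^+ 2 by rewrite expr2 ler_peMl ?(ltW K0).
  by rewrite lef_pV2 ?posrE ?mulr_gt0 ?exprn_gt0//; lra.
have fin n : b <= 2 * vnorm (u n) + rho -> ((b ^+ 2 / 32 / L ^+ 2)%:E <= avg_prob coin n L)%E.
  move=> bu; apply: le_trans (damped_sum_le_avg_prob coin T n L0 nrq).
  rewrite nrq lee_fin.
  have ub : b / 4 <= vnorm (u n) by lra.
  have -> : b ^+ 2 / 32 / L ^+ 2 = L^-1 ^+ 2 * ((b / 4) ^+ 2 / 2) by field; rewrite gt_eqF.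
  have Li : 0 <= L^-1 by rewrite invr_ge0 ltW.
  have b4 : 0 <= b / 4 by lra.
  apply: ler_pM; first exact: sqr_ge0.
  - by rewrite divr_ge0 ?sqr_ge0.
  - by rewrite ler_pXn2r ?nnegrE//; lra.
  - by rewrite ler_pM2r ?invr_gt0// ler_pXn2r ?nnegrE ?vnorm_ge0.
apply: on_one_side_impl fin _.
exact: resolvent_one_sided_lower coinE (fun n => ca (x n)) (fun n => cD (x n)) q1 r01
  K0 N0 WE dW WK ue erho Nk Ne.
Qed.

(** Only the [h] sites at distance between [h + 1] and [2 h] are kept; [f] selects the
    side of the origin. *)
Lemma moment_ge (coin : int -> 'M[C]_2) (p L c : R) (h : nat) (f : nat -> int) :
  0 < p -> 0 <= c -> (forall i, `|f i|%N = i) ->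
  (forall i, (0 < i <= h.*2)%N -> (c%:E <= avg_prob coin (f i) L)%E) ->
  ((h%:R * (h%:R `^ p * c))%:E <= moment coin p L)%E.
Proof.
move=> p0 c0 fi fc; pose s := [seq f i | i <- index_iota h.+1 h.*2.+1].
apply: esum_ge; exists [set` s]; first by split=> //; exact: finite_seq.
rewrite -fsbig_seq; last first.
  by rewrite map_inj_uniq ?iota_uniq// => i k fik; rewrite -(fi i) fik fi.
rewrite big_map.
apply: (@le_trans _ _ (\sum_(h.+1 <= i < h.*2.+1) (h%:R `^ p * c)%:E)%E).
  rewrite sumEFin lee_fin sumr_const_nat subSS -addnn addnK mulr_natl//.
rewrite big_seq [leRHS]big_seq; apply: lee_sum => i; rewrite mem_index_iota => /andP[hi ih].
rewrite EFinM; apply: lee_pmul; rewrite ?lee_fin ?powR_ge0//; last first.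
  by apply: fc; lia.
apply: ge0_ler_powR; rewrite ?nnegrE ?addr_ge0 ?(ltW p0)//.
have -> : `|(f i)%:~R| = i%:R :> R by rewrite -intr_norm -abszE fi.
by rewrite natr1 ler_nat; lia.
Qed.

(** With [h] of order [L], [moment_ge] bounds the moment below by a constant times
    [L ^ (p - 1)], and the constant disappears in the limit. *)
Lemma lower_transport_ge (coin : int -> 'M[C]_2) (p c d : R) :
  0 < p -> 0 < c -> 0 < d ->
  (forall (L : R) (N : nat), 4 <= L -> (0 < N)%N -> N%:R <= d * L ->
    on_one_side N (fun n => (c / L ^+ 2)%:E <= avg_prob coin n L)%E) ->
  ((1 - 1 / p)%:E <= lower_transport coin p)%E.
Proof.
move=> p0 c0 d0 spread; apply/lee_addgt0Pr => eps eps0.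
(* [ln (moment coin p L) >= (p - 1) ln L + B], and [L > L1] makes [B / (p ln L)] at
   least [- eps]. *)
pose B := (p + 1) * ln (d / 4) + ln c.
pose L1 := expR (`|B| / (p * eps)).
rewrite /lower_transport limf_einfE -leeBlDr// -EFinB.
apply: (@le_trans _ _ (ereal_inf (log_ratio coin p @` [set L | 4 + 4 / d + L1 < L]))); last first.
  apply: ereal_sup_ubound; exists [set L | 4 + 4 / d + L1 < L] => //.
  by apply: nbhs_pinfty_gt; exact: num_real.
apply: le_ereal_inf_tmp => _ [L /= LL <-].
have L1_gt0 : 0 < L1 by exact: expR_gt0.
have d4 : 0 < 4 / d by rewrite divr_gt0.
have L4 : 4 <= L by lra.
have L0 : 0 < L by lra.
have dL : 4 <= d * L by rewrite mulrC -ler_pdivrMr//; lra.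
have lnL : 0 < ln L by rewrite ln_gt0//; lra.
have lnL1 : `|B| / (p * eps) <= ln L.
  by rewrite -[leLHS]expRK ler_ln ?posrE//; rewrite -/L1; lra.
(* [4 / d < L] makes the rounding harmless: [d L / 4 <= h <= d L / 2]. *)
pose h := Num.trunc (d * L / 2).
have /andP[h1 h2] : h%:R <= d * L / 2 < h.+1%:R by apply: truncn_itv; lra.
have h0 : d / 4 * L <= h%:R by move: h2; rewrite -(natr1 h); lra.
have hN : h.*2%:R <= d * L by rewrite -muln2 natrM; lra.
have hgt : 0 < h%:R :> R by lra.
have h2gt : (0 < h.*2)%N by rewrite double_gt0 -(ltr_nat R).
have cL : 0 < c / L ^+ 2 by rewrite divr_gt0// exprn_gt0.
have mom : ((h%:R * (h%:R `^ p * (c / L ^+ 2)))%:E <= moment coin p L)%E.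
  have [H|H] := spread L h.*2 L4 h2gt hN.
    by apply: (moment_ge (f := Posz)) => // [|i /andP[_ ih]]; [exact: ltW | exact: H].
  apply: (moment_ge (f := fun i => - i%:Z)) => //; first exact: ltW.
  by move=> i; rewrite abszN.
set m := h%:R * _ in mom.
have m0 : 0 < m by do 2 apply: mulr_gt0 => //; exact: powR_gt0.
have lnm : (p - 1) * ln L + B <= ln m.
  rewrite /m !lnM ?posrE ?mulr_gt0 ?powR_gt0// ?invr_gt0 ?exprn_gt0//.
  rewrite ln_powR lnV ?posrE ?exprn_gt0// lnXn//.
  have : ln (d / 4) + ln L <= ln h%:R.
    by rewrite -lnM ?posrE ?divr_gt0// ler_ln ?posrE// !mulr_gt0// divr_gt0.
  rewrite /B; set l4 := ln (d / 4); set lh := ln h%:R => lh4.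
  have : (p + 1) * (l4 + ln L) <= (p + 1) * lh by rewrite ler_wpM2l//; lra.
  rewrite mulr2n; lra.
have plnL : 0 < p * ln L by rewrite mulr_gt0.
have lne_m : ((ln m)%:E <= lne (moment coin p L))%E.
  rewrite -lne_EFin// lee_lne// in_itv/= ?leey ?andbT ?lee_fin ?(ltW m0)//.
  by apply: le_trans mom; rewrite lee_fin ltW.
apply: (@le_trans _ _ ((ln m)%:E * (p * ln L)^-1%:E)%E); last first.
  by apply: lee_wpmul2r => //; rewrite lee_fin invr_ge0 ltW.
rewrite -EFinM lee_fin ler_pdivlMr//.
apply: le_trans lnm.
have -> : (1 - 1 / p - eps) * (p * ln L) = (p - 1) * ln L - p * eps * ln L.
  by field; rewrite gt_eqF.
have : `|B| <= ln L * (p * eps) by rewrite -ler_pdivrMr// mulr_gt0.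
have := ler_norm (- B); rewrite normrN; lra.
Qed.

Lemma lower_le_upper_transport (coin : int -> 'M[C]_2) (p : R) :
  (lower_transport coin p <= upper_transport coin p)%E.
Proof.
rewrite /lower_transport /upper_transport limf_einfE limf_esupE.
apply: ge_ereal_sup => _ [V FV <-]; apply: le_ereal_inf_tmp => _ [V' FV' <-].
have [L [VL V'L]] := filter_ex (filterI FV FV').
apply: (@le_trans _ _ (log_ratio coin p L)).
  by apply: ereal_inf_lbound; exists L.
by apply: ereal_sup_ubound; exists L.
Qed.

End Spreading.

Unset Implicit Arguments.

Theorem theorem1p2 (R : realType) (theta phi : R) (x : int -> bool)
    (htheta : 0 < theta < pi / 2) (hphi : 0 < phi < pi / 2)
    (hx : thue_morse x) (p : R) (hp : 0 < p) :
  (lower_transport (tm_coins x theta phi) p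
     <= upper_transport (tm_coins x theta phi) p)%E /\
  ((1 - 1 / p)%:E <= lower_transport (tm_coins x theta phi) p)%E.
Proof.
split; first exact: lower_le_upper_transport.
have [[c d] /= [c0 d0 H]] := thue_morse_one_sided htheta hphi.
by apply: (lower_transport_ge hp c0 d0) => L N L4 N0 NL; exact: H.
Qed.
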